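(* Let $$f(z)={}_2F_1\left(\tfrac16,\tfrac13;1;z\right),\qquad\phi(x)=\frac{108x^2}{(1-4x)^3},\qquad y(x)=\frac{1}{\sqrt{1-4x}}\,f\bigl(\phi(x)\bigr).$$ Then: (a) The map $\phi\colon\mathbb{P}^1\to\mathbb{P}^1$ is a Belyi map of degree $3$, ramified only over $\{0,1,\infty\}$, with ramification passport $[2{+}1,\,2{+}1,\,3]$ (over $0,1,\infty$ respectively). (b) The function $y(x)$ satisfies the Heun equation $$x(1-4x)(1-16x)\,y''+(1-30x+128x^2)\,y'-2(1-8x)\,y=0.$$ (c) $G(x):=y(x)^2=\sum_{n\ge0}D_nx^n$, where $(D_n)$ are the Domb numbers (OEIS A002895). The function $G$ satisfies the symmetric square of the Heun equation in (b), namely $$\bigl[\theta_x^3-2x(2\theta_x+1)(5\theta_x^2+5\theta_x+2)+64x^2(\theta_x+1)^3\bigr]G=0.$$ (d) In particular, the Domb kernel (the recurrence $(n+1)^3D_{n+1}=2(2n+1)(5n^2+5n+2)D_n-64n^3D_{n-1}$) arises from the rank-$2$ Gauss object ${}_2F_1(\tfrac16,\tfrac13;1;z)$ by three successive operations: pullback by the Belyi map $\phi$, algebraic twist by $1/\sqrt{1-4x}$, and $\operatorname{Sym}^2$.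
   Context: $\theta_x=x\,\frac{d}{dx}$, and primes denote $\frac{d}{dx}$. Functions are considered as power series near $x=0$, with $1/\sqrt{1-4x}=1+2x+\cdots$. A Belyi map is a nonconstant map $\mathbb{P}^1\to\mathbb{P}^1$ ramified only over $\{0,1,\infty\}$; its passport lists the ramification indices over each of these points. The Domb numbers are $D_n=\sum_{k=0}^n\binom nk^2\binom{2k}k\binom{2n-2k}{n-k}$ ($1,4,28,256,2716,\dots$). The symmetric square of a second-order linear differential equation is the third-order linear differential equation satisfied by all products of two of its solutions. *)

(* Defs.v *)
From HB Require Import structures.
From mathcomp Require Import all_boot all_order all_algebra.
From mathcomp Require Import fraction generic_quotient.
From mathcomp Require Import boolp ring.

Set Implicit Arguments.
Unset Strict Implicit.
Unset Printing Implicit Defensive.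

Import Order.TTheory GRing.Theory Num.Theory.
Local Open Scope ring_scope.

(* Extensionality and the classical eqType and choiceType structures of boolp are
   what makes power series over an arbitrary field a ring in the library's sense. *)
Record fps (F : Type) := Fps { fps_coef :> nat -> F }.

HB.instance Definition _ (F : Type) := gen_eqMixin (fps F).
HB.instance Definition _ (F : Type) := gen_choiceMixin (fps F).

Lemma fpsP (F : Type) (f g : fps F) : f =1 g -> f = g.
Proof. by case: f => f; case: g => g /funext /= ->. Qed.

Section FpsRing.
Variable F : fieldType.
Implicit Types f g h : fps F.

Definition fps_zero : fps F := Fps (fun _ => 0).
Definition fps_one : fps F := Fps (fun n => (n == 0%N)%:R).
Definition fps_opp f : fps F := Fps (fun n => - f n).
Definition fps_add f g : fps F := Fps (fun n => f n + g n).
Definition fps_mul f g : fps F := Fps (fun n => \sum_(i < n.+1) f i * g (n - i)%N).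

Fact fps_addA : associative fps_add.
Proof. by move=> f g h; apply: fpsP => n /=; rewrite addrA. Qed.
Fact fps_addC : commutative fps_add.
Proof. by move=> f g; apply: fpsP => n /=; rewrite addrC. Qed.
Fact fps_add0 : left_id fps_zero fps_add.
Proof. by move=> f; apply: fpsP => n /=; rewrite add0r. Qed.
Fact fps_addN : left_inverse fps_zero fps_opp fps_add.
Proof. by move=> f; apply: fpsP => n /=; rewrite addNr. Qed.

HB.instance Definition _ :=
  GRing.isZmodule.Build (fps F) fps_addA fps_addC fps_add0 fps_addN.

(* [fps_mul] is compared with the product of truncations in [{poly F}]. *)
Let trunc m f : {poly F} := \poly_(i < m) f i.

Let coef_fps_mul m f g n : (n < m)%N -> (trunc m f * trunc m g)`_n = fps_mul f g n.
Proof.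
move=> lt_nm; rewrite coefM; apply: eq_bigr => i _.
rewrite !coef_poly (leq_trans _ lt_nm) 1?(leq_trans (ltn_ord i)) //.
by rewrite (leq_ltn_trans (leq_subr _ _) lt_nm).
Qed.

Fact fps_mulC : commutative fps_mul.
Proof.
move=> f g; apply: fpsP => n.
by rewrite -!(coef_fps_mul _ _ (ltnSn n)) mulrC.
Qed.

Fact fps_mulA : associative fps_mul.
Proof.
move=> f g h; apply: fpsP => n.
transitivity ((trunc n.+1 f * (trunc n.+1 g * trunc n.+1 h))`_n).
  rewrite coefM; apply: eq_bigr => i _.
  by rewrite coef_poly ltn_ord (@coef_fps_mul n.+1) // ltnS leq_subr.
rewrite mulrA coefM; apply: eq_bigr => i _.
by rewrite (@coef_fps_mul n.+1) ?ltn_ord // coef_poly ltnS leq_subr.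
Qed.

Fact fps_mul1 : left_id fps_one fps_mul.
Proof.
move=> f; apply: fpsP => n /=.
by rewrite big_ord_recl /= mul1r subn0 big1 ?addr0 // => i _; rewrite mul0r.
Qed.

Fact fps_mulDl : left_distributive fps_mul +%R.
Proof.
move=> f g h; apply: fpsP => n; rewrite /= -big_split /=.
by apply: eq_bigr => i _; rewrite mulrDl.
Qed.

Fact fps_one_neq0 : fps_one != 0.
Proof.
apply/eqP => /(congr1 (fun f : fps F => f 0%N)) /= /eqP.
by rewrite oner_eq0.
Qed.

HB.instance Definition _ := GRing.Zmodule_isComNzRing.Build (fps F)
  fps_mulA fps_mulC fps_mul1 fps_mulDl fps_one_neq0.

(* [fps_inv_seq f n] lists the coefficients 0 .. n of 1/f. *)
Fixpoint fps_inv_seq f n : seq F :=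
  if n isn't m.+1 then [:: (f 0%N)^-1] else
  let s := fps_inv_seq f m in
  rcons s (- (f 0%N)^-1 * \sum_(i < m.+1) s`_i * f (m.+1 - i)%N).

Definition fps_unit : {pred fps F} := fun f => f 0%N != 0.
Definition fps_inv f : fps F :=
  if f \in fps_unit then Fps (fun n => (fps_inv_seq f n)`_n) else f.

Let size_inv_seq f n : size (fps_inv_seq f n) = n.+1.
Proof. by elim: n => //= n IHn; rewrite size_rcons IHn. Qed.

Let nth_inv_seq f n i : (i <= n)%N -> (fps_inv_seq f n)`_i = (fps_inv_seq f i)`_i.
Proof.
elim: n => [|n IHn]; first by rewrite leqn0 => /eqP ->.
rewrite leq_eqVlt => /predU1P[-> //|lt_in].
by rewrite /= nth_rcons size_inv_seq lt_in IHn.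
Qed.

Fact fps_mulVr : {in fps_unit, left_inverse 1 fps_inv *%R}.
Proof.
move=> f Uf; apply: fpsP => -[|n] /=; rewrite /fps_inv Uf /=.
  by rewrite big_ord_recl big_ord0 addr0 mulVf.
rewrite big_ord_recr /= nth_rcons size_inv_seq ltnn eqxx subnn.
rewrite mulrAC mulNr mulVf // mulN1r.
apply/eqP; rewrite subr_eq0; apply/eqP; apply: eq_bigr => i _.
by rewrite [in RHS]nth_inv_seq // -ltnS.
Qed.

Fact fps_unitP f g : g * f = 1 -> f \in fps_unit.
Proof.
move/(congr1 (fun h : fps F => h 0%N)) => /=.
rewrite big_ord_recl big_ord0 addr0 subn0 => gf1.
by apply/eqP => f0; move/eqP: gf1; rewrite f0 mulr0 eq_sym oner_eq0.
Qed.

Fact fps_inv_out : {in [predC fps_unit], fps_inv =1 id}.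
Proof. by move=> f; rewrite inE /fps_inv => /negPf ->. Qed.

HB.instance Definition _ := GRing.ComNzRing_hasMulInverse.Build (fps F)
  fps_mulVr fps_unitP fps_inv_out.

Definition fps_of_poly (p : {poly F}) : fps F := Fps (fun n => p`_n).
Definition fpsX : fps F := fps_of_poly 'X.
Definition fps_deriv f : fps F := Fps (fun n => f n.+1 *+ n.+1).

(* The composite f(g(x)), for g with g(0) = 0: the coefficient of x^m then
   only involves the terms f_n g^n with n <= m. *)
Definition fps_comp f g : fps F :=
  Fps (fun m => \sum_(n < m.+1) f n * (g ^+ n : fps F) m).

(* (1 + c x)^a *)
Definition fps_binomial (a c : F) : fps F :=
  Fps (fun n => (\prod_(i < n) (a - i%:R)) / n`!%:R * c ^+ n).

Definition pochhammer (a : F) (n : nat) : F := \prod_(i < n) (a + i%:R).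
Definition hypergeo (a b c : F) : fps F :=
  Fps (fun n => pochhammer a n * pochhammer b n / (pochhammer c n * n`!%:R)).

Lemma fps_derivM f g : fps_deriv (f * g) = fps_deriv f * g + f * fps_deriv g.
Proof.
apply: fpsP => n.
transitivity (((trunc n.+2 f * trunc n.+2 g)^`())`_n).
  by rewrite coef_deriv (@coef_fps_mul n.+2).
rewrite derivM coefD !coefM; congr (_ + _); apply: eq_bigr => i _ /=.
  rewrite coef_deriv !coef_poly ltnS ltn_ord.
  by rewrite (leq_ltn_trans (leq_subr _ _)).
rewrite coef_deriv !coef_poly (ltn_trans (ltn_ord i)) //.
by rewrite !ltnS leq_subr.
Qed.

Lemma fps_coefCM c g m : (fps_of_poly c%:P * g : fps F) m = c * g m.
Proof.
rewrite /= big_ord_recl /= subn0 coefC eqxx big1 ?addr0 // => i _.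
by rewrite coefC mul0r.
Qed.

Lemma fps_natE k : k%:R = fps_of_poly (k%:R%:P) :> fps F.
Proof.
elim: k => [|k IHk]; apply: fpsP => n /=; first by rewrite coefC if_same.
by rewrite -natr1 IHk /= !coefC -natr1; case: n => //= n; rewrite addr0.
Qed.

Lemma fps_coefXM g m : (fpsX * g : fps F) m = if m is k.+1 then g k else 0.
Proof.
case: m => [|m] /=; first by rewrite big_ord_recl big_ord0 coefX mul0r addr0.
rewrite 2!big_ord_recl /= !coefX /= mul0r add0r mul1r big1 ?addr0 => [|i _].
  by rewrite subSS subn0.
by rewrite coefX mul0r.
Qed.

End FpsRing.

Arguments fpsX {F}.

(* The projective line; [None] is the point at infinity. *)
Definition P1 (C : Type) := option C.
Local Notation oo := None (only parsing).
Local Notation "p %:F" := (tofrac p).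

Section RationalMaps.
Variable C : fieldType.
Implicit Types (phi g : {fraction {poly C}}) (P Q : P1 C).

(* [repr phi] need not be in lowest terms. *)
Definition rnum phi : {poly C} :=
  let r := repr phi in r.1 %/ gcdp r.1 r.2.
Definition rden phi : {poly C} :=
  let r := repr phi in r.2 %/ gcdp r.1 r.2.

Definition ratdeg phi : nat := (maxn (size (rnum phi)) (size (rden phi))).-1.

(* The map P^1 -> P^1, by evaluating the homogenized numerator and denominator
   at [a : 1], resp. at [1 : 0]. *)
Definition rateval phi P : P1 C :=
  let: (u, v) := if P is Some a then ((rnum phi).[a], (rden phi).[a])
                 else ((rnum phi)`_(ratdeg phi), (rden phi)`_(ratdeg phi)) in
  if v == 0 then oo else Some (u / v).

(* The order of vanishing; meaningful for g != 0. *)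
Definition ratord g P : int :=
  if P is Some a then (mup a (rnum g))%:Z - (mup a (rden g))%:Z
  else (size (rden g))%:Z - (size (rnum g))%:Z.

(* The pullback by phi of the standard local coordinate at Q, which is t - b
   at a finite point b and 1/t at infinity. *)
Definition pull_coord phi Q : {fraction {poly C}} :=
  if Q is Some b then phi - (b%:P)%:F else phi^-1.

Definition ram_index phi P : nat := `|ratord (pull_coord phi (rateval phi P)) P|%N.

Definition is_belyi phi : Prop :=
  ~ (exists Q, forall P, rateval phi P = Q) /\
  (forall P, (1 < ram_index phi P)%N ->
     rateval phi P \in [:: Some 0; Some 1; oo]).

Definition ram_indices_over phi Q (s : seq nat) : Prop :=
  exists Ps : seq (P1 C),
    [/\ uniq Ps, forall P, (P \in Ps) = (rateval phi P == Q)
      & perm_eq [seq ram_index phi P | P <- Ps] s].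

Definition has_passport phi (s0 s1 soo : seq nat) : Prop :=
  [/\ ram_indices_over phi (Some 0) s0, ram_indices_over phi (Some 1) s1
    & ram_indices_over phi oo soo].

End RationalMaps.

(* [LinOp w c] is the operator \sum_i c_i(x) (w(x) d/dx)^i: w = 1 for operators
   written in d/dx, w = x for operators written in theta = x d/dx.  The type
   {poly {poly C}} only records the coefficients c_i, placed on the left of the
   powers of the derivation; its product is not composition of operators, except
   that it does compute p(theta) q(theta) for p, q with constant coefficients. *)
Record linop (C : nzRingType) :=
  LinOp { op_field : {poly C}; op_coefs : {poly {poly C}} }.

Definition op_order (C : nzRingType) (L : linop C) : nat :=
  if op_field L == 0 then 0 else (size (op_coefs L)).-1.

(* The action of L on u, where e gives the values of polynomials in x and D is
   the derivation d/dx. *)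
Definition op_act (C : nzRingType) (R : nzRingType) (e : {poly C} -> R)
    (D : R -> R) (L : linop C) (u : R) : R :=
  \sum_(i < size (op_coefs L))
     e (op_coefs L)`_i * iter i (fun v => e (op_field L) * D v) u.

Definition fps_act (F : fieldType) : linop F -> fps F -> fps F :=
  op_act (@fps_of_poly F) (@fps_deriv F).

(* A differential field (K, D) extending (C(x), d/dx) by means of j. *)
Definition diff_ext (C : fieldType) (K : fieldType)
    (j : {rmorphism {fraction {poly C}} -> K}) (D : K -> K) : Prop :=
  [/\ forall u v, D (u + v) = D u + D v,
      forall u v, D (u * v) = D u * v + u * D v
    & forall p : {poly C}, D (j p%:F) = j (p^`())%:F].

Definition ext_act (C : fieldType) (K : fieldType)
    (j : {rmorphism {fraction {poly C}} -> K}) (D : K -> K) :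
    linop C -> K -> K :=
  op_act (fun p => j p%:F) D.

(* The symmetric square: the third-order equation satisfied by all products of
   two solutions.  Solutions are taken in arbitrary differential extensions of
   C(x), since there need not be a full set of power series solutions at 0; as
   the products of solutions span a space of dimension 3 in some extension, M is
   determined up to a factor in C(x). *)
Definition is_sym_square (C : fieldType) (L M : linop C) : Prop :=
  [/\ op_order L = 2%N, op_order M = 3%N
    & forall (K : fieldType) (j : {rmorphism {fraction {poly C}} -> K})
        (D : K -> K), diff_ext j D ->
      forall u v : K, ext_act j D L u = 0 -> ext_act j D L v = 0 ->
        ext_act j D M (u * v) = 0].

(* The action on K of an operator in the variable z = phi(x): polynomials p(z) take
   the values p(phi(x)) and d/dz is (1/phi') d/dx. *)
Definition pull_act (C : fieldType) (phi : {fraction {poly C}})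
    (K : fieldType) (j : {rmorphism {fraction {poly C}} -> K}) (D : K -> K) :
    linop C -> K -> K :=
  op_act (fun p => j (map_poly (fun c : C => (c%:P)%:F) p).[phi])
         (fun u => D u / D (j phi)).

Definition is_pullback (C : fieldType) (phi : {fraction {poly C}})
    (L M : linop C) : Prop :=
  op_order M = op_order L /\
  forall (K : fieldType) (j : {rmorphism {fraction {poly C}} -> K})
    (D : K -> K), diff_ext j D ->
  forall u : K, pull_act phi j D L u = 0 <-> ext_act j D M u = 0.

(* M is the twist of L by the algebraic function s with minimal polynomial m:
   the solutions of M are the s u with u a solution of L. *)
Definition is_alg_twist (C : fieldType) (m : {poly {fraction {poly C}}})
    (L M : linop C) : Prop :=
  op_order M = op_order L /\
  forall (K : fieldType) (j : {rmorphism {fraction {poly C}} -> K})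
    (D : K -> K), diff_ext j D ->
  forall s : K, root (map_poly j m) s ->
  forall u : K, ext_act j D L u = 0 <-> ext_act j D M (s * u) = 0.

Definition phi_of (K : unitRingType) (x : K) : K :=
  108 * x ^+ 2 / (1 - 4 * x) ^+ 3.

Section Domb.
Variable C : numClosedFieldType.

Definition phi_rat : {fraction {poly C}} := phi_of ('X : {poly C})%:F.
Definition phi_fps : fps C := phi_of fpsX.

Definition f_gauss : fps C := hypergeo 6^-1 3^-1 1.

(* The branch 1 + 2x + ... of 1/sqrt(1 - 4x); see [inv_sqrt_sqr]. *)
Definition inv_sqrt : fps C := fps_binomial (- 2^-1) (- 4).

(* The minimal polynomial T^2 - 1/(1 - 4x) of 1/sqrt(1 - 4x) over C(x). *)
Definition inv_sqrt_minpoly : {poly {fraction {poly C}}} :=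
  'X^2 - ((1 - 4 * ('X : {poly C})%:F)^-1)%:P.

Lemma inv_sqrt_ode :
  (1 - 4 * fpsX) * fps_deriv inv_sqrt = 2 * inv_sqrt.
Proof.
apply: fpsP => n; rewrite mulrBl mul1r -mulrA !fps_natE.
have addE (g h : fps C) k : (g + h) k = g k + h k by [].
have oppE (g : fps C) k : (- g) k = - g k by [].
rewrite addE oppE !fps_coefCM fps_coefXM.
have step m : m.+1%:R * inv_sqrt m.+1 = (2 + 4 * m%:R) * inv_sqrt m.
  rewrite /inv_sqrt /= big_ord_recr /= factS natrM exprS.
  have n1 : m.+1%:R != 0 :> C by rewrite pnatr_eq0.
  have n2 : m`!%:R != 0 :> C by rewrite pnatr_eq0 -lt0n fact_gt0.
  have n3 : 2%:R != 0 :> C by rewrite pnatr_eq0.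
  by field; rewrite n2 addrC natr1 n1.
have dE k : fps_deriv inv_sqrt k = (2 + 4 * k%:R) * inv_sqrt k.
  by rewrite -step mulr_natl.
case: n => [|n]; first by rewrite dE; ring.
by rewrite !dE -(step n); ring.
Qed.

Lemma inv_sqrt_sqr :
  inv_sqrt 0%N = 1 /\ (1 - 4 * fpsX) * inv_sqrt ^+ 2 = 1.
Proof.
have s0 : inv_sqrt 0%N = 1 by rewrite /= big_ord0 fact0 invr1 !mulr1.
split=> //; set w := _ * _.
have w' : fps_deriv w = 0.
  have d1 : fps_deriv (1 - 4 * fpsX) = - 4 :> fps C.
    apply: fpsP => n; rewrite !fps_natE /fps_deriv.
    rewrite -[LHS]/((0 - (fps_of_poly 4%:P * fpsX : fps C) n.+1) *+ n.+1).
    rewrite fps_coefCM -[LHS]/((0 - 4 * ('X : {poly C})`_n.+1) *+ n.+1).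
    rewrite -[RHS]/(- (4%:P : {poly C})`_n) coefX coefC.
    case: n => [|n] /=; first by rewrite mulr1 sub0r.
    by rewrite mulr0 subrr mul0rn oppr0.
  rewrite /w expr2 !fps_derivM d1.
  have -> : (1 - 4 * fpsX) * (fps_deriv inv_sqrt * inv_sqrt
      + inv_sqrt * fps_deriv inv_sqrt)
      = 2 * inv_sqrt * ((1 - 4 * fpsX) * fps_deriv inv_sqrt) by ring.
  by rewrite inv_sqrt_ode; ring.
apply: fpsP => -[|n].
  have mul0E (f g : fps C) : (f * g) 0%N = f 0%N * g 0%N.
    by rewrite /= big_ord_recl big_ord0 addr0.
  rewrite /w expr2 !mul0E s0 !mulr1 fps_natE.
  rewrite -[LHS]/(1 - (fps_of_poly 4%:P * fpsX : fps C) 0%N).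
  by rewrite mul0E /= coefX mulr0 subr0.
move/(congr1 (fun f : fps C => f n)): w' => /= /eqP.
by rewrite mulrn_eq0 => /eqP.
Qed.

Definition y_fps : fps C := inv_sqrt * fps_comp f_gauss phi_fps.

(* The equation theta (theta + c - 1) u = z (theta + a) (theta + b) u of
   2F1(a, b; c; z), with theta = z d/dz. *)
Definition gauss_op (a b c : C) : linop C :=
  let z : {poly {poly C}} := 'X%:P in
  let theta : {poly {poly C}} := 'X in
  let cst (k : C) : {poly {poly C}} := k%:P%:P in
  LinOp 'X (theta * (theta + cst (c - 1))
            - z * (theta + cst a) * (theta + cst b)).

Definition heun_op : linop C :=
  let x : {poly {poly C}} := 'X%:P in
  let d : {poly {poly C}} := 'X in
  LinOp 1 (x * (1 - 4 * x) * (1 - 16 * x) * d ^+ 2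
           + (1 - 30 * x + 128 * x ^+ 2) * d - 2 * (1 - 8 * x)).

Definition domb_op : linop C :=
  let x : {poly {poly C}} := 'X%:P in
  let theta : {poly {poly C}} := 'X in
  LinOp 'X (theta ^+ 3
            - 2 * x * (2 * theta + 1) * (5 * theta ^+ 2 + 5 * theta + 2)
            + 64 * x ^+ 2 * (theta + 1) ^+ 3).

(* For n = 0 the last term vanishes, so that the value of c at 0.-1 = 0 is
   irrelevant. *)
Definition domb_recurrence (c : nat -> C) : Prop :=
  forall n : nat,
    n.+1%:R ^+ 3 * c n.+1 =
      2 * (2 * n%:R + 1) * (5 * n%:R ^+ 2 + 5 * n%:R + 2) * c n
      - 64 * n%:R ^+ 3 * c n.-1.

End Domb.

Definition domb (n : nat) : nat :=
  (\sum_(k < n.+1) 'C(n, k) ^ 2 * 'C(2 * k, k) * 'C(2 * n - 2 * k, n - k))%N.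

(* Main.v *)
Require Import Defs.
From HB Require Import structures.
From mathcomp Require Import all_boot all_order all_algebra.
From mathcomp Require Import fraction generic_quotient.
From mathcomp Require Import ring zify.

Set Implicit Arguments.
Unset Strict Implicit.
Unset Printing Implicit Defensive.

Import Order.TTheory GRing.Theory Num.Theory.
Local Open Scope ring_scope.

(** Every differential statement here is a polynomial identity in a commutative
ring with a derivation D and an element x with D x = 1.  Both the ring of power
series and an arbitrary differential extension of C(x) are of this kind, so each
identity is checked once and used twice: to see that the series f(phi(x)), y and
y^2 solve their equations, and to relate the operators themselves.

- Pullback ([gauss_pullback]).  Since x (1 - 4x) phi' = 2 (1 + 2x) phi, the
  derivation z d/dz becomes x (1 - 4x) / (2 (1 + 2x)) d/dx for z = phi(x), and
  1 - phi = (1 + 2x)^2 (1 - 16x) / (1 - 4x)^3.  Substituting in the Gauss equation,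
  the factor 1 + 2x at the ramified point over 1 disappears, because the exponents
  0, 1/2 of the Gauss equation at 1 are doubled to 0, 1.  What remains is
  x (1 - 16x) (1 - 4x)^2 u'' + (1 - 4x) (1 - 26x + 64x^2) u' - 24 x u = 0.
- Twist ([heun_twist]).  For s' = 2 s / (1 - 4x), the Heun operator applied to s u
  is s / (1 - 4x) times the pulled back operator applied to u.
- Symmetric square ([domb_of_product]).  The Domb operator applied to u v is a
  combination of H u, H v and their derivatives, H being the Heun operator.

That y^2 is the generating function of the Domb numbers then follows from the
recurrence that the Domb operator imposes on coefficients, once the Domb numbers
are known to satisfy it.  For this, let g be the sum of the x^n / n!^2, which is
I_0(2 sqrt x).  By Vandermonde's identity the coefficients of g^2 are
binomial(2n, n) / n!^2, hence D_n / n!^2 is the n-th coefficient of g^4.  From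
theta^2 g = x g it follows that g^4 is killed by an explicit operator of order 5,
the fourth symmetric power of theta^2 - x ([bessel_fourth_power]), and this is the
recurrence sought.

For the Belyi property, a fraction in lowest terms p / q takes the value b at a
with ramification index the multiplicity of a as a root of p - b q
([ram_index_finite]).  At a double root p' - b q' vanishes too, which together
with p = b q forces a (1 + 2a) = 0, so that b is 0 or 1. *)

(** * Identities in rings with a derivation *)

Section DerivationIdentities.
Variables (R : comNzRingType) (D : R -> R).
Hypothesis DD : forall u v, D (u + v) = D u + D v.
Hypothesis DM : forall u v, D (u * v) = D u * v + u * D v.

Lemma derivation0 : D 0 = 0.
Proof. by apply: (addrI (D 0)); rewrite -DD !addr0. Qed.

Lemma derivation1 : D 1 = 0.
Proof.
by have /eqP := DM 1 1; rewrite !mulr1 mul1r -subr_eq0 opprD addNKr oppr_eq0 => /eqP.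
Qed.

Lemma derivationN u : D (- u) = - D u.
Proof. by apply/eqP; rewrite -addr_eq0 -DD addNr derivation0. Qed.

Lemma derivation_nat n : D n%:R = 0.
Proof. by elim: n => [|n IHn]; rewrite ?derivation0 // -natr1 DD IHn derivation1 addr0. Qed.

Lemma derivationXn u n : D (u ^+ n.+1) = n.+1%:R * u ^+ n * D u.
Proof.
elim: n => [|n IHn]; first by rewrite expr1 expr0; ring.
by rewrite exprS DM IHn -[n.+2%:R]natr1 exprS; ring.
Qed.

Let derivE := (DD, derivationN, DM, derivation_nat, derivation1, derivationXn).

(** The operators are written out as expressions in D and x with integer
coefficients, so that they make sense, and [ring] can compute with them, in every
commutative ring with a derivation. *)
Definition heun (x u : R) : R :=
  x * (1 - 4 * x) * (1 - 16 * x) * D (D u)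
  + (1 - 30 * x + 128 * x ^+ 2) * D u - 2 * (1 - 8 * x) * u.

(** The equation of f(phi(x)); see [gauss_pullback]. *)
Definition pulled_gauss (x u : R) : R :=
  x * (1 - 16 * x) * (1 - 4 * x) ^+ 2 * D (D u)
  + (1 - 4 * x) * (1 - 26 * x + 64 * x ^+ 2) * D u - 24 * x * u.

(** The Domb operator expanded in powers of theta, here [th]. *)
Definition domb_theta (th : R -> R) (x u : R) : R :=
  (64 * x ^+ 2 - 4 * x) * u + (192 * x ^+ 2 - 18 * x) * th u
  + (192 * x ^+ 2 - 30 * x) * th (th u)
  + (1 - 20 * x + 64 * x ^+ 2) * th (th (th u)).

Variable x : R.
Hypothesis Dx : D x = 1.

(** With H the Heun operator and a the coefficient of its second derivative, the
leading coefficient of the Domb operator is x^2 a, so x^2 (v (H u)' + u (H v)')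
has the same third derivatives of u and v.  Cancelling the second derivatives in
the difference by multiples of H u and H v leaves nothing.  The argument divides
by nothing, hence holds in rings with zero divisors. *)
Lemma domb_of_product u v : heun x u = 0 -> heun x v = 0 ->
  domb_theta (fun w => x * D w) x (u * v) = 0.
Proof.
move=> hu hv.
have -> : domb_theta (fun w => x * D w) x (u * v) =
    x ^+ 2 * (v * D (heun x u) + u * D (heun x v))
    + 3 * x ^+ 2 * (D v * heun x u + D u * heun x v)
    + x * (v * heun x u + u * heun x v).
  by rewrite /domb_theta /heun !(derivE, Dx); ring.
by rewrite hu hv derivation0; ring.
Qed.

(** The hypothesis says that s is a multiple of 1/sqrt(1 - 4x).  Then s' and s''
are rational multiples of s, and s can be factored out of H(s u). *)
Lemma heun_twist s u : (1 - 4 * x) * D s = 2 * s ->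
  (1 - 4 * x) * heun x (s * u) = s * pulled_gauss x u.
Proof.
pose E := (1 - 4 * x) * D s - 2 * s.
move=> ds; have E0 : E = 0 by rewrite /E ds subrr.
(* E and (1 - 4x) E' + 6 E, which equals (1 - 4x)^2 s'' - 12 s, eliminate the
   derivatives of s. *)
transitivity (s * pulled_gauss x u
    + x * (1 - 16 * x) * u * ((1 - 4 * x) * D E + 6 * E)
    + 2 * x * (1 - 16 * x) * (1 - 4 * x) * D u * E
    + (1 - 30 * x + 128 * x ^+ 2) * u * E).
  by rewrite /E /heun /pulled_gauss !(derivE, Dx); ring.
by rewrite E0 derivation0; ring.
Qed.

(** This is the logarithmic derivative of phi, whose finite zeros and poles
are 0 and 1/4.  The inverse c of 1 - 4x allows its cube to be cancelled. *)
Lemma phi_deriv ph c : c * (1 - 4 * x) = 1 ->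
  ph * (1 - 4 * x) ^+ 3 = 108 * x ^+ 2 ->
  x * (1 - 4 * x) * D ph = 2 * (1 + 2 * x) * ph.
Proof.
pose E := ph * (1 - 4 * x) ^+ 3 - 108 * x ^+ 2.
move=> cK phE; have E0 : E = 0 by rewrite /E phE subrr.
apply/eqP; rewrite -subr_eq0; apply/eqP.
have c3 : c ^+ 3 * (1 - 4 * x) ^+ 3 = 1 by rewrite -exprMn cK expr1n.
rewrite -[LHS]mul1r -[X in X * _]c3 -mulrA.
transitivity (c ^+ 3 * (x * (1 - 4 * x) * D E - 2 * (1 - 4 * x) * E)); last first.
  by rewrite E0 derivation0; ring.
by rewrite /E !(derivE, Dx); ring.
Qed.

(** Here t and t2 stand for theta u and theta^2 u, with theta = z d/dz and
z = [ph]: by [phi_deriv] the operator theta is x (1 - 4x) / (2 (1 + 2x)) d/dx.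
The factor 18 on the Gauss operator clears the denominators of 1/6 + 1/3 and
1/6 * 1/3, and (1 - 4x)^3 those of phi. *)
Lemma gauss_pullback ph u t t2 :
  ph * (1 - 4 * x) ^+ 3 = 108 * x ^+ 2 ->
  x * (1 - 4 * x) * D u = 2 * (1 + 2 * x) * t ->
  x * (1 - 4 * x) * D t = 2 * (1 + 2 * x) * t2 ->
  4 * (1 - 4 * x) ^+ 3 * (18 * t2 - ph * (18 * t2 + 9 * t + u)) =
  18 * x * pulled_gauss x u.
Proof.
pose Eph := ph * (1 - 4 * x) ^+ 3 - 108 * x ^+ 2.
pose Et := 2 * (1 + 2 * x) * t - x * (1 - 4 * x) * D u.
pose Et2 := 2 * (1 + 2 * x) * t2 - x * (1 - 4 * x) * D t.
move=> phE tE t2E.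
have Eph0 : Eph = 0 by rewrite /Eph phE subrr.
have Et0 : Et = 0 by rewrite /Et tE subrr.
have Et20 : Et2 = 0 by rewrite /Et2 t2E subrr.
(* The multiples of Et2 and of its companion D Et express t2 by the second
   derivative of u; the remaining t carries the factor
   54 x + (1 - 4x)(1 - 16x) = (1 + 2x)(1 + 32x), so that Et can eliminate it. *)
transitivity (18 * x * pulled_gauss x u - 4 * (18 * t2 + 9 * t + u) * Eph
   + 36 * (1 - 16 * x) * (1 + 2 * x) * Et2
   + 18 * (1 - 16 * x) * x * (1 - 4 * x) * D Et
   - 36 * x * (1 + 32 * x) * Et); last first.
  by rewrite Eph0 Et0 Et20 derivation0; ring.
by rewrite /Eph /Et /Et2 /pulled_gauss !(derivE, Dx); ring.
Qed.

End DerivationIdentities.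

Section BesselFourthPower.
Variables (R : comNzRingType) (D : R -> R).
Hypothesis DD : forall u v, D (u + v) = D u + D v.
Hypothesis DM : forall u v, D (u * v) = D u * v + u * D v.

Let derivE := (DD, derivationN DD, DM, derivation_nat DD DM, derivation1 DM, derivationXn DM).

(** With D = theta, this is the fourth symmetric power of theta^2 - x.  The
products g^(4-i) h^i with h = theta g span a module of rank 5 that is stable under
theta, so g^4 satisfies an equation of order 5. *)
Lemma bessel_fourth_power x g : D x = x -> D (D g) = x * g ->
  let G := g ^+ 4 in
  D (D (D (D (D G)))) - x * (4 * G + 18 * D G + 30 * D (D G) + 20 * D (D (D G)))
  + 64 * x ^+ 2 * (D G + G) = 0.
Proof.
move=> Dx Dh G; have [h Dg] : {h | D g = h} by exists (D g).
rewrite Dg in Dh.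
have D1 : D G = 4 * g ^+ 3 * h.
  by rewrite /G !(derivE, Dg); ring.
have D2 : D (D G) = 12 * g ^+ 2 * h ^+ 2 + 4 * x * g ^+ 4.
  by rewrite D1 !(derivE, Dx, Dg, Dh); ring.
have D3 : D (D (D G)) = 24 * g * h ^+ 3 + 40 * x * g ^+ 3 * h + 4 * x * g ^+ 4.
  by rewrite D2 !(derivE, Dx, Dg, Dh); ring.
have D4 : D (D (D (D G))) = 24 * h ^+ 4 + 192 * x * g ^+ 2 * h ^+ 2
    + 56 * x * g ^+ 3 * h + (40 * x ^+ 2 + 4 * x) * g ^+ 4.
  by rewrite D3 !(derivE, Dx, Dg, Dh); ring.
by rewrite D4 D3 D2 D1 !(derivE, Dx, Dg, Dh) /G; ring.
Qed.

End BesselFourthPower.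

(** * Action and order of the operators *)

Section Operators.
Variables (C R : nzRingType) (e : {poly C} -> R) (D : R -> R).

(** Lists of coefficients are easier to act with than the factored forms in which
the operators are given. *)
Lemma op_act_Poly w (s : seq {poly C}) u : e 0 = 0 ->
  op_act e D (LinOp w (Poly s)) u =
  \sum_(i < size s) e s`_i * iter i (fun v => e w * D v) u.
Proof.
move=> e0; rewrite /op_act /=.
rewrite (big_ord_widen _ (fun i => e (Poly s)`_i * iter i (fun v => e w * D v) u)
  (size_Poly s)) big_mkcond /=.
apply: eq_bigr => i _; rewrite coef_Poly.
by case: ltnP => // le_i; rewrite -(coef_Poly s) nth_default // e0 mul0r.
Qed.

End Operators.

Lemma op_order_Poly (C : nzRingType) (w : {poly C}) s :
  w != 0 -> last 1 s != 0 -> op_order (LinOp w (Poly s)) = (size s).-1.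
Proof.
by move=> w0 s0; rewrite /op_order /= (negPf w0) (@PolyK _ 1).
Qed.

(** The operator that links the Gauss and the Heun equations. *)
Definition pulled_gauss_op (C : numClosedFieldType) : linop C :=
  LinOp 1 (Poly [:: - 24 * 'X; (1 - 4 * 'X) * (1 - 26 * 'X + 64 * 'X ^+ 2);
     'X * (1 - 16 * 'X) * (1 - 4 * 'X) ^+ 2 ]).

Section OperatorShapes.
Variable C : numClosedFieldType.

Lemma heun_op_Poly : heun_op C = LinOp 1 (Poly [:: - 2 * (1 - 8 * 'X);
  1 - 30 * 'X + 128 * 'X ^+ 2; 'X * (1 - 4 * 'X) * (1 - 16 * 'X)]).
Proof. by rewrite /heun_op; congr LinOp; rewrite /= !cons_poly_def; ring. Qed.

Lemma domb_op_Poly : domb_op C = LinOp 'X (Poly [:: 64 * 'X ^+ 2 - 4 * 'X;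
  192 * 'X ^+ 2 - 18 * 'X; 192 * 'X ^+ 2 - 30 * 'X; 1 - 20 * 'X + 64 * 'X ^+ 2]).
Proof. by rewrite /domb_op; congr LinOp; rewrite /= !cons_poly_def; ring. Qed.

Lemma gauss_op_Poly (a b c : C) : gauss_op a b c = LinOp 'X (Poly
  [:: - (a * b)%:P * 'X; (c - 1)%:P - (a + b)%:P * 'X; 1 - 'X]).
Proof.
rewrite /gauss_op; congr LinOp; rewrite /= !cons_poly_def !(rmorphD, rmorphM) /=.
by ring.
Qed.

Variables (R : comNzRingType) (e : {rmorphism {poly C} -> R}) (D : R -> R).

Let actE := (fun w s u => @op_act_Poly _ _ e D w s u (rmorph0 e), big_ord_recl, big_ord0).

Lemma act_heun u : op_act e D (heun_op C) u = heun D (e 'X) u.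
Proof. by rewrite heun_op_Poly !actE /= rmorph1 !mul1r /heun; ring. Qed.

Lemma act_pulled_gauss u :
  op_act e D (pulled_gauss_op C) u = pulled_gauss D (e 'X) u.
Proof. by rewrite !actE /= rmorph1 !mul1r /pulled_gauss; ring. Qed.

Lemma act_domb u :
  op_act e D (domb_op C) u = domb_theta (fun v => e 'X * D v) (e 'X) u.
Proof. by rewrite domb_op_Poly !actE /= /domb_theta; ring. Qed.

Lemma act_gauss (a b c : C) u (th := fun v => e 'X * D v) :
  op_act e D (gauss_op a b c) u = th (th u) + e (c - 1)%:P * th u
    - e 'X * (th (th u) + e (a + b)%:P * th u + e (a * b)%:P * u).
Proof. by rewrite gauss_op_Poly !actE /= /th; ring. Qed.

(** The factor 18 leaves only integer coefficients, as in [gauss_pullback]. *)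
Lemma act_gauss_sixth_third u (th := fun v => e 'X * D v) :
  18 * op_act e D (gauss_op 6^-1 3^-1 1) u =
  18 * th (th u) - e 'X * (18 * th (th u) + 9 * th u + u).
Proof.
have eq (k : C) n m : m%:R * k = n%:R -> m%:R * e k%:P = n%:R.
  by move/(congr1 (fun k => e k%:P)); rewrite polyCM rmorphM !polyC_natr !rmorph_nat.
have e1 : 18 * e (6^-1 + 3^-1)%:P = 9 by apply: eq; field.
have e2 : 18 * e (6^-1 * 3^-1)%:P = 1 by apply: (eq _ 1%N); field.
rewrite act_gauss subrr polyC0 rmorph0.
transitivity (18 * th (th u) - e 'X * (18 * th (th u) +
  18 * e (6^-1 + 3^-1)%:P * th u + 18 * e (6^-1 * 3^-1)%:P * u)).
  by rewrite /th; ring.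
by rewrite e1 e2 mul1r.
Qed.

End OperatorShapes.

Section OperatorOrders.
Variable C : numClosedFieldType.

Lemma poly_neq0_at (p : {poly C}) a : p.[a] != 0 -> p != 0.
Proof. by apply: contraNneq => ->; rewrite horner0. Qed.

Lemma linear_neq0 (a : C) : 1 + a *: 'X != 0.
Proof. by apply: (@poly_neq0_at _ 0); rewrite !hornerE oner_eq0. Qed.

Lemma one_sub_natX_neq0 n : 1 - n%:R * 'X != 0 :> {poly C}.
Proof. by rewrite mulr_natl -scaler_nat -scaleNr linear_neq0. Qed.

Lemma one_add_natX_neq0 n : 1 + n%:R * 'X != 0 :> {poly C}.
Proof. by rewrite mulr_natl -scaler_nat linear_neq0. Qed.

Lemma heun_order : op_order (heun_op C) = 2%N.
Proof.
rewrite heun_op_Poly op_order_Poly ?oner_eq0 //=.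
by rewrite !mulf_neq0 ?polyX_eq0 ?one_sub_natX_neq0.
Qed.

Lemma pulled_gauss_order : op_order (pulled_gauss_op C) = 2%N.
Proof.
rewrite op_order_Poly ?oner_eq0 //=.
by rewrite !mulf_neq0 ?expf_neq0 ?polyX_eq0 ?one_sub_natX_neq0.
Qed.

Lemma gauss_order (a b c : C) : op_order (gauss_op a b c) = 2%N.
Proof.
by rewrite gauss_op_Poly op_order_Poly ?polyX_eq0 //= -['X]mul1r (one_sub_natX_neq0 1).
Qed.

Lemma domb_order : op_order (domb_op C) = 3%N.
Proof.
rewrite domb_op_Poly op_order_Poly ?polyX_eq0 //=.
have -> : 1 - 20 * 'X + 64 * 'X ^+ 2 = (1 - 4 * 'X) * (1 - 16 * 'X) :> {poly C}.
  by ring.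
by rewrite mulf_neq0 ?one_sub_natX_neq0.
Qed.

End OperatorOrders.

(** * Formal power series: theta and composition *)

Section FormalPowerSeries.
Variable F : fieldType.
Implicit Types f g h : fps F.

Lemma fps_coefD f g n : (f + g : fps F) n = f n + g n. Proof. by []. Qed.
Lemma fps_coefN f n : (- f : fps F) n = - f n. Proof. by []. Qed.

Lemma fps_coef_natM k f n : (k%:R * f : fps F) n = k%:R * f n.
Proof. by rewrite fps_natE fps_coefCM. Qed.

Lemma fps_coef0M f g : (f * g : fps F) 0%N = f 0%N * g 0%N.
Proof. by rewrite /= big_ord_recl big_ord0 addr0. Qed.

Lemma fps_of_poly_is_zmod_morphism : zmod_morphism (@fps_of_poly F).
Proof. by move=> p q; apply: fpsP => n; rewrite /= coefB. Qed.

Lemma fps_of_poly_is_monoid_morphism : monoid_morphism (@fps_of_poly F).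
Proof.
split=> [|p q]; apply: fpsP => n; first by rewrite /= coef1.
by rewrite /= coefM.
Qed.

HB.instance Definition _ := GRing.isZmodMorphism.Build {poly F} (fps F)
  (@fps_of_poly F) fps_of_poly_is_zmod_morphism.
HB.instance Definition _ := GRing.isMonoidMorphism.Build {poly F} (fps F)
  (@fps_of_poly F) fps_of_poly_is_monoid_morphism.

Lemma fps_derivD f g : fps_deriv (f + g) = fps_deriv f + fps_deriv g.
Proof. by apply: fpsP => n; rewrite /= mulrnDl. Qed.

Lemma fps_derivX : fps_deriv fpsX = 1 :> fps F.
Proof. by apply: fpsP => -[|n]; rewrite /= coefX // mul0rn. Qed.

Definition fps_theta f := fpsX * fps_deriv f.

Lemma fps_thetaE f n : fps_theta f n = n%:R * f n.
Proof. by rewrite /fps_theta fps_coefXM; case: n => [|n]; rewrite ?mul0r //= mulr_natl. Qed.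

Lemma fps_thetaD f g : fps_theta (f + g) = fps_theta f + fps_theta g.
Proof. by rewrite /fps_theta fps_derivD mulrDr. Qed.

Lemma fps_thetaM f g : fps_theta (f * g) = fps_theta f * g + f * fps_theta g.
Proof. by rewrite /fps_theta fps_derivM; ring. Qed.

(** Multiplication by x is a shift; division by x is needed because
[gauss_pullback] only gives x times the pulled back equation. *)
Lemma fpsX_regular : GRing.lreg (fpsX : fps F).
Proof.
move=> f g fg; apply: fpsP => n.
by have := congr1 (fun h : fps F => h n.+1) fg; rewrite !fps_coefXM.
Qed.

Lemma fps_exp_small g n m : g 0%N = 0 -> (m < n)%N -> (g ^+ n : fps F) m = 0.
Proof.
move=> g0; elim: n m => // n IHn m lt_mn; rewrite exprS /= big1 // => -[[|i] lt_i] _ /=.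
  by rewrite g0 mul0r.
by rewrite IHn ?mulr0 //; lia.
Qed.

Lemma fps_compE f g m :
  fps_comp f g m = \sum_(n < m.+1) f n * (g ^+ n : fps F) m.
Proof. by []. Qed.

(** The number N of terms may be any bound above m, since g^n has no coefficient
below n.  Having the same N for all coefficients lets sums be exchanged, and the
factor h serves the chain rule. *)
Lemma fps_comp_mulE f g h N m : g 0%N = 0 -> (m < N)%N ->
  (fps_comp f g * h : fps F) m = \sum_(n < N) f n * (g ^+ n * h : fps F) m.
Proof.
move=> g0 lt_mN.
transitivity (\sum_(i < m.+1) (\sum_(n < N) f n * (g ^+ n : fps F) i) * h (m - i)%N).
  apply: eq_bigr => i _; congr (_ * _).
  have le_iN : (i.+1 <= N)%N by apply: leq_trans lt_mN; rewrite ltnS -ltnS.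
  rewrite [LHS](big_ord_widen _ (fun n => f n * (g ^+ n : fps F) i) le_iN).
  rewrite big_mkcond /=; apply: eq_bigr => n _; case: ltnP => // lt_in.
  by rewrite fps_exp_small ?mulr0.
under eq_bigr do rewrite mulr_suml.
rewrite exchange_big /=; apply: eq_bigr => n _.
by rewrite mulr_sumr; apply: eq_bigr => i _; rewrite mulrA.
Qed.

Lemma fps_compD f1 f2 g : fps_comp (f1 + f2) g = fps_comp f1 g + fps_comp f2 g.
Proof. by apply: fpsP => m; rewrite /= -big_split; apply: eq_bigr => n _; rewrite /= mulrDl. Qed.

Lemma fps_compN f g : fps_comp (- f) g = - fps_comp f g.
Proof. by apply: fpsP => m; rewrite /= -sumrN; apply: eq_bigr => n _; rewrite /= mulNr. Qed.

Lemma fps_comp_natM k f g : fps_comp (k%:R * f) g = k%:R * fps_comp f g.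
Proof.
apply: fpsP => m; rewrite fps_coef_natM !fps_compE mulr_sumr.
by apply: eq_bigr => n _; rewrite fps_coef_natM mulrA.
Qed.

Lemma fps_comp0 g : fps_comp 0 g = 0.
Proof. by apply: fpsP => m; rewrite /= big1 // => n _; rewrite mul0r. Qed.

Lemma fps_compXM f g : g 0%N = 0 -> fps_comp (fpsX * f) g = g * fps_comp f g.
Proof.
move=> g0; apply: fpsP => m; rewrite [g * _]mulrC (fps_comp_mulE _ _ g0 (ltnSn m)).
rewrite -[LHS]/((fps_comp (fpsX * f) g) m) -[fps_comp _ _]mulr1.
rewrite (fps_comp_mulE _ _ g0 (leqW (ltnSn m))) big_ord_recl fps_coefXM mul0r add0r.
by apply: eq_bigr => n _; rewrite fps_coefXM mulr1 exprSr.
Qed.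

Lemma fps_chain_rule f g : g 0%N = 0 ->
  fps_deriv (fps_comp f g) = fps_comp (fps_deriv f) g * fps_deriv g.
Proof.
move=> g0; apply: fpsP => m; rewrite (fps_comp_mulE _ _ g0 (ltnSn m)).
rewrite -[fps_comp f g]mulr1.
rewrite -[LHS]/((fps_comp f g * 1 : fps F) m.+1 *+ m.+1).
rewrite (fps_comp_mulE _ _ g0 (ltnSn m.+1)) -sumrMnl big_ord_recl.
rewrite mulr1 [X in X *+ _]/= mulr0 mul0rn add0r; apply: eq_bigr => n _.
rewrite mulr1 -mulrnAr.
rewrite -[X in f _ * X]/(fps_deriv (g ^+ n.+1) m).
rewrite (derivationXn (@fps_derivM F)) -mulrA fps_coef_natM /=.
by rewrite mulr_natl mulrnAr mulrnAl.
Qed.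

End FormalPowerSeries.

(** * Power series solutions *)

Section PowerSeriesSolutions.
Variable C : numClosedFieldType.
Local Notation X := (fpsX : fps C).

Lemma domb_act_coef (c : fps C) n :
  (fps_act (domb_op C) c : fps C) n =
  n%:R ^+ 3 * c n - (if n is m.+1 then
      (4 + 18 * m%:R + 30 * m%:R ^+ 2 + 20 * m%:R ^+ 3) * c m else 0)
  + (if n is m.+2 then 64 * m.+1%:R ^+ 3 * c m else 0).
Proof.
have thE : (fun v : fps C => fps_of_poly 'X * fps_deriv v) = @fps_theta C by [].
rewrite /fps_act act_domb thE -/fpsX.
have -> : domb_theta (@fps_theta C) X c =
    fps_theta (fps_theta (fps_theta c))
    - X * (4 * c + 18 * fps_theta c + 30 * fps_theta (fps_theta c)
           + 20 * fps_theta (fps_theta (fps_theta c)))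
    + X * (X * (64 * (c + 3 * fps_theta c + 3 * fps_theta (fps_theta c)
           + fps_theta (fps_theta (fps_theta c))))).
  by rewrite /domb_theta; ring.
rewrite !fps_coefD fps_coefN 3!fps_thetaE 2!fps_coefXM; congr (_ - _ + _).
- by ring.
- by case: n => // n; rewrite !(fps_coefD, fps_coef_natM, fps_thetaE); ring.
- case: n => // -[|n]; rewrite fps_coefXM //.
  by rewrite !(fps_coefD, fps_coef_natM, fps_thetaE) -natr1; ring.
Qed.

Lemma domb_act_recurrence (c : nat -> C) :
  fps_act (domb_op C) (Fps c) = 0 <-> domb_recurrence c.
Proof.
have coefE n : (fps_act (domb_op C) (Fps c) : fps C) n.+1 =
    n.+1%:R ^+ 3 * c n.+1 - (2 * (2 * n%:R + 1) * (5 * n%:R ^+ 2 + 5 * n%:R + 2) * c n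
      - 64 * n%:R ^+ 3 * c n.-1).
  rewrite domb_act_coef /=; case: n => [|n] /=; first by ring.
  by ring.
split=> [act0 n | rec]; last first.
  apply: fpsP => -[|n]; first by rewrite domb_act_coef -[RHS]/0; ring.
  by rewrite coefE rec subrr.
by apply/eqP; rewrite -subr_eq0 -coefE act0.
Qed.

(** At n = 0 the coefficient of c n.-1 vanishes, so one initial value is enough. *)
Lemma domb_recurrence_uniq (c d : nat -> C) :
  domb_recurrence c -> domb_recurrence d -> c 0%N = d 0%N -> c =1 d.
Proof.
move=> recc recd cd0 n; elim/ltn_ind: n => -[//|n] IHn.
have n3 : n.+1%:R ^+ 3 != 0 :> C by rewrite expf_neq0 // pnatr_eq0.
apply: (mulfI n3); rewrite recc recd !IHn //.
by case: (n) => // m; apply: leqW.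
Qed.

Lemma gauss_hypergeo (a b c : C) : (forall n, c + n%:R != 0) ->
  fps_act (gauss_op a b c) (hypergeo a b c) = 0.
Proof.
move=> c0; apply: fpsP => n; set f := hypergeo a b c.
have step m : m.+1%:R * (c + m%:R) * f m.+1 = (a + m%:R) * (b + m%:R) * f m.
  rewrite /f /= /pochhammer !big_ord_recr /= factS natrM.
  have m1 : m.+1%:R != 0 :> C by rewrite pnatr_eq0.
  have m2 : m`!%:R != 0 :> C by rewrite pnatr_eq0 -lt0n fact_gt0.
  have pc : \prod_(i < m) (c + i%:R) != 0 by apply/prodf_neq0 => i _; apply: c0.
  by field; rewrite m2 pc c0 addrC natr1 m1.
have thE v : fps_of_poly 'X * fps_deriv v = fps_theta v :> fps C by [].
rewrite /fps_act act_gauss !thE -/fpsX.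
rewrite !fps_coefD fps_coefN fps_coefCM 2!fps_thetaE fps_coefXM.
case: n => [|n]; first by rewrite -[RHS]/0; ring.
rewrite !(fps_coefD, fps_coefCM, fps_thetaE) -[RHS]/0.
transitivity (n.+1%:R * (c + n%:R) * f n.+1 - (a + n%:R) * (b + n%:R) * f n).
  by rewrite -natr1; ring.
by rewrite step subrr.
Qed.

Lemma one_sub_4X_unit : (1 - 4 * X) \is a GRing.unit.
Proof.
rewrite /in_mem /= /fps_unit; rewrite -[(_ - _ : fps C) _]/(1 - (4 * X : fps C) 0%N).
by rewrite fps_coef0M /= coefX mulr0 subr0 oner_eq0.
Qed.

Lemma phi_fps_cube : phi_fps C * (1 - 4 * X) ^+ 3 = 108 * X ^+ 2.
Proof. by rewrite /phi_fps /phi_of divrK // unitrX // one_sub_4X_unit. Qed.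

Lemma phi_fps0 : phi_fps C 0%N = 0.
Proof.
rewrite /phi_fps /phi_of fps_coef0M expr2 mulrA fps_coef0M.
by rewrite [X 0%N]/= coefX mulr0 mul0r.
Qed.

Lemma gauss_f_gauss : fps_act (gauss_op 6^-1 3^-1 1) (f_gauss C) = 0.
Proof. by apply: gauss_hypergeo => n; rewrite addrC natr1 pnatr_eq0. Qed.

(** The hypotheses on t and t2 in [gauss_pullback], for series in z = phi(x). *)
Lemma theta_comp_phi (f : fps C) :
  X * (1 - 4 * X) * fps_deriv (fps_comp f (phi_fps C)) =
  2 * (1 + 2 * X) * fps_comp (fps_theta f) (phi_fps C).
Proof.
rewrite /fps_theta fps_compXM ?phi_fps0 // fps_chain_rule ?phi_fps0 //.
rewrite mulrCA (phi_deriv (@fps_derivD C) (@fps_derivM C) (fps_derivX C)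
  (mulVr one_sub_4X_unit) phi_fps_cube); ring.
Qed.

Lemma pulled_gauss_f_phi :
  pulled_gauss (@fps_deriv C) X (fps_comp (f_gauss C) (phi_fps C)) = 0.
Proof.
have gauss18 : 0 = 18 * fps_theta (fps_theta (f_gauss C)) - X *
    (18 * fps_theta (fps_theta (f_gauss C)) + 9 * fps_theta (f_gauss C) + f_gauss C).
  rewrite -[LHS](mulr0 18) -gauss_f_gauss.
  exact: (act_gauss_sixth_third (@fps_of_poly C) (@fps_deriv C)).
have /(congr1 (fun f => fps_comp f (phi_fps C))) := gauss18.
rewrite fps_comp0 fps_compD fps_compN fps_compXM ?phi_fps0 //.
rewrite !fps_compD !fps_comp_natM => /esym comp18.
have := gauss_pullback (@fps_derivD C) (@fps_derivM C) (fps_derivX C)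
  phi_fps_cube (theta_comp_phi (f_gauss C)) (theta_comp_phi _).
rewrite comp18 mulr0 -mulrA => /esym.
have u18 : 18 \is a @GRing.unit (fps C).
  by rewrite fps_natE /in_mem /= /fps_unit /= coefC pnatr_eq0.
by rewrite -[RHS](mulr0 18) => /(mulrI u18); rewrite -[RHS](mulr0 X) => /fpsX_regular.
Qed.

Lemma heun_y : fps_act (heun_op C) (y_fps C) = 0.
Proof.
rewrite /fps_act act_heun; apply: (mulrI one_sub_4X_unit).
rewrite (heun_twist (@fps_derivD C) (@fps_derivM C) (fps_derivX C)); last exact: inv_sqrt_ode.
by rewrite pulled_gauss_f_phi !mulr0.
Qed.

Lemma domb_y2 : fps_act (domb_op C) (y_fps C ^+ 2) = 0.
Proof.
have := heun_y; rewrite /fps_act act_heun act_domb expr2 => hy.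
exact: (domb_of_product (@fps_derivD C) (@fps_derivM C) (fps_derivX C)).
Qed.

Lemma y_fps0 : y_fps C 0%N = 1.
Proof.
rewrite fps_coef0M (proj1 (inv_sqrt_sqr C)) mul1r /= big_ord_recl big_ord0.
by rewrite /pochhammer !big_ord0 /= fact0 !mulr1 invr1 !mulr1 addr0.
Qed.

End PowerSeriesSolutions.

(** * Domb numbers *)

Section DombNumbers.
Variable C : numClosedFieldType.
Local Notation X := (fpsX : fps C).

(** The series of I_0(2 sqrt x). *)
Definition bessel : fps C := Fps (fun n => n`!%:R ^- 2).

Let fact_neq0 n : n`!%:R != 0 :> C.
Proof. by rewrite pnatr_eq0 -lt0n fact_gt0. Qed.

Lemma bessel_ode : fps_theta (fps_theta bessel) = X * bessel.
Proof.
apply: fpsP => n; rewrite !fps_thetaE fps_coefXM.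
case: n => [|n]; first by rewrite mul0r.
rewrite /= factS natrM; field.
by rewrite fact_neq0 addrC natr1 pnatr_eq0.
Qed.

Lemma natr_bin n k : (k <= n)%N -> 'C(n, k)%:R = n`!%:R / (k`!%:R * (n - k)`!%:R) :> C.
Proof.
move=> le_kn; rewrite -(bin_fact le_kn) !natrM mulfK //.
by rewrite mulf_neq0 ?fact_neq0.
Qed.

Lemma bessel_sqr n : (bessel ^+ 2 : fps C) n = 'C(2 * n, n)%:R / n`!%:R ^+ 2.
Proof.
rewrite mul2n -addnn -binomial.Vandermonde natr_sum mulr_suml; apply: eq_bigr => i _ /=.
have le_in : (i <= n)%N by rewrite -ltnS.
rewrite (bin_sub le_in) natrM natr_bin //; field.
by rewrite !fact_neq0.
Qed.

(** The two squares of g supply the two central binomial coefficients, and the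
factorials combine to the square of the binomial coefficient of n and k. *)
Lemma domb_bessel n : (domb n)%:R = n`!%:R ^+ 2 * (bessel ^+ 4 : fps C) n.
Proof.
rewrite (exprM bessel 2 2) [in RHS]expr2 /domb natr_sum mulr_sumr; apply: eq_bigr => i _.
have le_in : (i <= n)%N by rewrite -ltnS.
rewrite !bessel_sqr !natrM -mulnBr natr_bin //; field.
by rewrite !fact_neq0.
Qed.

Lemma domb_numbers_recurrence : domb_recurrence (fun n => (domb n)%:R : C).
Proof.
set G := bessel ^+ 4; pose th := @fps_theta C.
have thX : th X = X by rewrite /th /fps_theta fps_derivX mulr1.
have ode : th (th (th (th (th G))))
    - X * (4 * G + 18 * th G + 30 * th (th G) + 20 * th (th (th G)))
    + X * (X * (64 * (th G + G))) = 0.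
  rewrite -(bessel_fourth_power (@fps_thetaD C) (@fps_thetaM C) thX bessel_ode).
  by rewrite -/th -/G; ring.
pose prev m : C := if m is k.+1 then 64 * m%:R * G k else 0.
have rec n : n.+1%:R ^+ 5 * G n.+1 =
    (20 * n%:R ^+ 3 + 30 * n%:R ^+ 2 + 18 * n%:R + 4) * G n
    - prev n.
  have := congr1 (fun f : fps C => f n.+1) ode.
  rewrite fps_coefD fps_coefD fps_coefN fps_coefXM fps_coefXM.
  rewrite !fps_thetaE.
  have -> : (4 * G + 18 * th G + 30 * th (th G) + 20 * th (th (th G)) : fps C) n =
      (20 * n%:R ^+ 3 + 30 * n%:R ^+ 2 + 18 * n%:R + 4) * G n.
    by rewrite !(fps_coefD, fps_coef_natM, fps_thetaE); ring.
  have -> : (X * (64 * (th G + G)) : fps C) n = prev n.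
    case: (n) => [|m]; rewrite fps_coefXM //.
    by rewrite /prev fps_coef_natM fps_coefD fps_thetaE -natr1; ring.
  move=> eq0; apply/subr0_eq; rewrite -[RHS]/((0 : fps C) n.+1) -eq0.
  by ring.
move=> n; rewrite !domb_bessel -/G factS natrM.
transitivity (n`!%:R ^+ 2 * (n.+1%:R ^+ 5 * G n.+1)); first by ring.
rewrite rec /prev; case: n => [|n] /=; first by ring.
by rewrite factS natrM; ring.
Qed.

(** Both sides satisfy the Domb recurrence and start with 1. *)
Lemma y_sqr_domb : y_fps C ^+ 2 = Fps (fun n => (domb n)%:R).
Proof.
apply: fpsP; apply: domb_recurrence_uniq.
- by apply/domb_act_recurrence; rewrite -[RHS](domb_y2 C); congr fps_act; case: (_ ^+ 2).
- exact: domb_numbers_recurrence.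
- rewrite expr2 fps_coef0M y_fps0 mulr1.
  by rewrite -[RHS]/((domb 0)%:R); have -> : domb 0 = 1%N by rewrite /domb big_ord_recl big_ord0.
Qed.

End DombNumbers.

(** * Ramification of rational functions *)

Section RationalFunctions.
Variable C : fieldType.
Implicit Types p q : {poly C}.
Local Notation "p %:F" := (@tofrac {poly C} p).

Lemma frac_repr (g : {fraction {poly C}}) :
  g * (frac (repr g)).2%:F = (frac (repr g)).1%:F.
Proof.
rewrite -[g in g * _]reprK; unlock tofrac; rewrite -[LHS]FracField.pi_mul.
apply/eqmodP; rewrite /= /FracField.equivf /FracField.mulf.
rewrite !numden_Ratio ?mulr1 ?oner_neq0 ?denom_ratioP //.
by rewrite mulrC.
Qed.

(** The representative of a fraction is arbitrary, so a presentation p / q in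
lowest terms determines [rnum] and [rden] only up to a common constant.  All
notions below are unaffected by that constant. *)
Lemma rnum_rden p q : coprimep p q -> q != 0 ->
  exists2 c, c != 0 & rnum (p%:F / q%:F) = c *: p /\ rden (p%:F / q%:F) = c *: q.
Proof.
move=> cpq q0; set g := p%:F / q%:F; rewrite /rnum /rden /=.
have d0 : (frac (repr g)).2 != 0 by apply: denom_ratioP.
set n := (frac (repr g)).1; set d := (frac (repr g)).2 in d0 *.
have gcd0 : gcdp n d != 0 by rewrite gcdp_eq0 negb_and d0 orbT.
have cop : coprimep (n %/ gcdp n d) (d %/ gcdp n d) by rewrite coprimep_div_gcd ?d0 ?orbT.
have cross : n %/ gcdp n d * q = d %/ gcdp n d * p.
  apply: (mulIf gcd0); rewrite mulrAC [RHS]mulrAC !divpK ?dvdp_gcdl ?dvdp_gcdr //.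
  apply/eqP; rewrite -tofrac_eq !tofracM -/n -/d.
  have := frac_repr g; rewrite -/n -/d => <-; rewrite /g mulrAC divfK ?tofrac_eq0 //.
  by rewrite mulrC.
set n1 := n %/ _ in cop cross *; set d1 := d %/ _ in cop cross *.
(* By coprimality q divides d1; the quotient k divides both n1 and d1, so it is
   constant. *)
have : q %| d1 by rewrite -(@Gauss_dvdpl _ _ p) 1?coprimep_sym // -cross dvdp_mull.
case/dvdpP => k d1E; have n1E : n1 = k * p.
  by apply: (mulIf q0); rewrite cross d1E; ring.
have : k %= 1 by move/coprimepP: cop; apply; rewrite ?n1E ?d1E dvdp_mulr.
rewrite -size_poly_eq1 => /size_poly1P[c c0 kE].
by exists c => //; rewrite n1E d1E kE !mul_polyC.
Qed.

Lemma mup_scale a c p : c != 0 -> mup a (c *: p) = mup a p.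
Proof. by move=> c0; rewrite -mul_polyC mupMr // rootC. Qed.

Lemma mup_deriv_root a p : (1 < mup a p)%N -> root p^`() a.
Proof.
have [->|p0] := eqVneq p 0; first by rewrite deriv0 root0.
rewrite mup_geq // => /dvdpP[r ->].
rewrite rootE expr2 mulrA derivM derivXsubC hornerD !hornerM hornerXsubC.
by rewrite subrr !(mulr0, mul0r) addr0.
Qed.

Section LowestTerms.
Variables p q : {poly C}.
Hypotheses (cpq : coprimep p q) (q0 : q != 0).
Local Notation g := (p%:F / q%:F).

Lemma ratord_infinity : ratord g None = (size q)%:Z - (size p)%:Z.
Proof.
by have [c c0 [nE dE]] := rnum_rden cpq q0; rewrite /ratord nE dE !size_scale.
Qed.

Lemma ratdeg_quot : ratdeg g = (maxn (size p) (size q)).-1.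
Proof.
by have [c c0 [nE dE]] := rnum_rden cpq q0; rewrite /ratdeg nE dE !size_scale.
Qed.

Lemma rateval_finite a :
  rateval g (Some a) = if root q a then None else Some (p.[a] / q.[a]).
Proof.
have [c c0 [nE dE]] := rnum_rden cpq q0; rewrite /rateval nE dE !hornerZ.
rewrite mulf_eq0 (negPf c0) /= -rootE; case: ifP => // _.
by rewrite -mulf_div divff ?mul1r.
Qed.

Lemma rateval_infinity : (size p < size q)%N -> rateval g None = Some 0.
Proof.
move=> lt_pq; have [c c0 [nE dE]] := rnum_rden cpq q0.
rewrite /rateval ratdeg_quot (maxn_idPr (ltnW lt_pq)) nE dE !coefZ.
rewrite mulf_eq0 (negPf c0) /= -/(lead_coef q) lead_coef_eq0 (negPf q0).
rewrite [p`__]nth_default ?mulr0 ?mul0r //.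
by case: (size q) lt_pq.
Qed.

Lemma rateval_eq_Some a b : (rateval g (Some a) == Some b) = root (p - b *: q) a.
Proof.
rewrite rateval_finite !rootE hornerD hornerN hornerZ subr_eq0.
case: ifP => [qa|/negbT qa].
  rewrite (eqP qa) mulr0; apply/esym/negbTE.
  by apply: coprimep_root qa; rewrite coprimep_sym.
by apply/eqP/eqP => [[<-]|->]; rewrite ?divfK // mulfK.
Qed.

Lemma rateval_eq_infinity a : (rateval g (Some a) == None) = root q a.
Proof. by rewrite rateval_finite; case: ifP. Qed.

(** The pulled back coordinate is (p - b q) / q, again in lowest terms, and q does
not vanish at a. *)
Lemma ram_index_finite a b : rateval g (Some a) = Some b ->
  ram_index g (Some a) = mup a (p - b *: q).
Proof.
move=> gab; rewrite /ram_index gab /pull_coord.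
have qa : ~~ root q a by move: gab; rewrite rateval_finite; case: ifP.
have -> : g - b%:P%:F = (p - b *: q)%:F / q%:F.
  rewrite tofracB -mul_polyC tofracM mulrBl mulfK // tofrac_eq0 //.
have [//|c c0 [nE dE]] := @rnum_rden (p - b *: q) q _ q0.
  by rewrite coprimep_sym addrC -mul_polyC -mulNr -polyCN coprimep_addl_mul coprimep_sym.
by rewrite /ratord nE dE !mup_scale // (mupNroot qa) subr0.
Qed.

Lemma ram_index_pole a : root q a -> ram_index g (Some a) = mup a q.
Proof.
move=> qa; rewrite /ram_index rateval_finite qa /pull_coord.
have pa : ~~ root p a by apply: coprimep_root qa; rewrite coprimep_sym.
have p0 : p != 0 by apply: contraNneq pa => ->; rewrite root0.
have -> : g^-1 = q%:F / p%:F by rewrite invf_div.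
have [|c c0 [nE dE]] := @rnum_rden q p _ p0; first by rewrite coprimep_sym.
by rewrite /ratord nE dE !mup_scale // (mupNroot pa) subr0.
Qed.

Lemma ram_index_infinity : (size p < size q)%N ->
  ram_index g None = (size q - size p)%N.
Proof.
move=> lt_pq; rewrite /ram_index rateval_infinity // /pull_coord tofrac0 subr0.
by rewrite ratord_infinity subzn // ltnW.
Qed.

End LowestTerms.
End RationalFunctions.

(** * The Belyi map *)

Section BelyiMap.
Variable C : numClosedFieldType.
Local Notation "p %:F" := (@tofrac {poly C} p).

Let p : {poly C} := 108 * 'X ^+ 2.
Let q : {poly C} := (1 - 4 * 'X) ^+ 3.

Let natr_neq0 n : n.+1%:R != 0 :> C. Proof. by rewrite pnatr_eq0. Qed.

Lemma phi_rat_quot : phi_rat C = p%:F / q%:F.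
Proof.
rewrite /phi_rat /phi_of /p /q rmorphM !rmorphXn rmorphB rmorphM rmorph1.
by rewrite !rmorph_nat.
Qed.

(* The three fibres are read off from the factorizations of p, q and p - q. *)
Let pE : p = 108%:P * ('X - 0%:P) ^+ 2.
Proof. by rewrite polyC0 subr0 polyC_natr. Qed.

Let qE : q = (- 64)%:P * ('X - (4^-1)%:P) ^+ 3.
Proof.
have c4 : 4 * (4^-1)%:P = 1 :> {poly C}.
  by rewrite -polyC_natr -polyCM mulfV.
transitivity ((4 * (4^-1)%:P - 4 * 'X) ^+ 3 : {poly C}); first by rewrite c4.
by rewrite polyCN polyC_natr; ring.
Qed.

Let pqE : p - 1 *: q = 64%:P * (('X - (- 2^-1)%:P) ^+ 2 * ('X - (16^-1)%:P)).
Proof.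
have c2 : 2 * (2^-1)%:P = 1 :> {poly C} by rewrite -polyC_natr -polyCM mulfV.
have c16 : 16 * (16^-1)%:P = 1 :> {poly C} by rewrite -polyC_natr -polyCM mulfV.
transitivity ((1 + 2 * 'X) ^+ 2 * (16 * 'X - 1) : {poly C}).
  by rewrite /p /q scale1r; ring.
transitivity ((2 * (2^-1)%:P + 2 * 'X) ^+ 2 * (16 * 'X - 16 * (16^-1)%:P) : {poly C}).
  by rewrite c2 c16.
by rewrite polyCN polyC_natr; ring.
Qed.

Let cpq : coprimep p q.
Proof.
rewrite pE qE !mul_polyC coprimepZl ?coprimepZr ?oppr_eq0 //.
rewrite coprimep_expl // coprimep_expr // coprimep_XsubC2 // subr0.
by rewrite invr_eq0.
Qed.

Let size_p : size p = 3%N.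
Proof. by rewrite pE mul_polyC size_scale // size_exp_XsubC. Qed.

Let size_q : size q = 4%N.
Proof. by rewrite qE mul_polyC size_scale ?oppr_eq0 // size_exp_XsubC. Qed.

Let q0 : q != 0. Proof. by rewrite -size_poly_eq0 size_q. Qed.

Let lt_pq : (size p < size q)%N. Proof. by rewrite size_p size_q. Qed.

Let root_p a : root (p - 0 *: q) a = (a == 0).
Proof. by rewrite scale0r subr0 pE mul_polyC rootZ // root_exp_XsubC. Qed.

Let root_q a : root q a = (a == 4^-1).
Proof. by rewrite qE mul_polyC rootZ ?oppr_eq0 // root_exp_XsubC. Qed.

Let root_pq a : root (p - 1 *: q) a = (a == - 2^-1) || (a == 16^-1).
Proof. by rewrite pqE mul_polyC rootZ // rootM root_exp_XsubC // root_XsubC. Qed.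

(** At a multiple root a of p - b q, both p = b q and p' = b q' hold.  Eliminating
b from 216 a = -12 b (1 - 4a)^2 and 108 a^2 = b (1 - 4a)^3 gives a (1 + 2a) = 0;
the values of phi at 0 and -1/2 are 0 and 1. *)
Lemma phi_critical_value a b : rateval (phi_rat C) (Some a) = Some b ->
  (1 < ram_index (phi_rat C) (Some a))%N -> b = 0 \/ b = 1.
Proof.
rewrite phi_rat_quot => gab; rewrite (ram_index_finite cpq q0 gab) => /mup_deriv_root.
have := rateval_eq_Some cpq q0 a b; rewrite gab eqxx => /esym.
have hnat n : (n%:R : {poly C}).[a] = n%:R by rewrite -polyC_natr hornerC.
have wa : (1 - 4 * 'X).[a] = 1 - 4 * a.
  by rewrite hornerD hornerC hornerN hornerM hnat hornerX.
have pa : p.[a] = 108 * a ^+ 2 by rewrite /p hornerM hnat hornerXn.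
have qa : q.[a] = (1 - 4 * a) ^+ 3 by rewrite /q horner_exp wa.
have -> : (p - b *: q)^`() = 216 * 'X - b *: (- 12 * (1 - 4 * 'X) ^+ 2).
  rewrite derivB derivZ /p /q.
  rewrite !(derivationXn (@derivM C), derivB, derivM, derivX).
  by rewrite !(derivation_nat (@derivD C) (@derivM C)) derivC; congr (_ - _ *: _); ring.
rewrite !rootE hornerD hornerN hornerZ pa qa => /eqP val0.
rewrite hornerD hornerM hnat hornerX hornerN hornerZ hornerM hornerN hnat.
rewrite horner_exp wa => /eqP der0.
(* 1 - 4a times the second equation plus 12 times the first. *)
have : 216 * (a * (1 + 2 * a)) == 0.
  apply/eqP; transitivity ((1 - 4 * a) * (216 * a - b * (- 12 * (1 - 4 * a) ^+ 2))
    + 12 * (108 * a ^+ 2 - b * (1 - 4 * a) ^+ 3)); first by ring.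
  by rewrite val0 der0 !mulr0 addr0.
rewrite mulf_eq0 (negPf (natr_neq0 215)) mulf_eq0 /= => /orP[/eqP a0|].
  left; transitivity (- (108 * a ^+ 2 - b * (1 - 4 * a) ^+ 3)).
    by rewrite a0; ring.
  by rewrite val0 oppr0.
rewrite addrC addr_eq0 => /eqP a2; right.
(* With 2a = -1, both 1 - 4a = 3 and 108 a^2 = 27. *)
have n27 := natr_neq0 26.
apply: (mulfI n27); rewrite mulr1; apply/subr0_eq.
transitivity (- (27 * (2 * a) ^+ 2 - b * (1 - 2 * (2 * a)) ^+ 3)).
  by rewrite a2; ring.
by rewrite -[RHS]oppr0 -val0; ring.
Qed.

Lemma phi_ratdeg : ratdeg (phi_rat C) = 3%N.
Proof. by rewrite phi_rat_quot ratdeg_quot // size_p size_q. Qed.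

Lemma phi_belyi : is_belyi (phi_rat C).
Proof.
have pole a : (rateval (phi_rat C) (Some a) == None) = (a == 4^-1).
  by rewrite phi_rat_quot rateval_eq_infinity // root_q.
split=> [[Q constQ]|[a|]].
- have := pole 0; have := pole 4^-1; rewrite !constQ eqxx => /eqP ->.
  by rewrite eqxx eq_sym invr_eq0 (negPf (natr_neq0 3)).
- case gab: (rateval _ _) => [b|] //.
  by move/(phi_critical_value gab) => [->|->]; rewrite !inE eqxx ?orbT.
- by rewrite phi_rat_quot ram_index_infinity // size_p size_q.
Qed.

Lemma phi_passport :
  has_passport (phi_rat C) [:: 2; 1]%N [:: 2; 1]%N [:: 3]%N.
Proof.
have val_oo := rateval_infinity cpq q0 lt_pq.
have eq_val := rateval_eq_Some cpq q0.
have ram_val a b : root (p - b *: q) a ->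
    ram_index (p%:F / q%:F) (Some a) = mup a (p - b *: q).
  by rewrite -eq_val => /eqP/(ram_index_finite cpq q0).
have half_neq : 2^-1 + 16^-1 != 0 :> C.
  suff -> : 2^-1 + 16^-1 = 9 / 16 :> C by rewrite mulf_neq0 ?invr_eq0.
  by field.
have neq1 : - 2^-1 == 16^-1 :> C = false.
  by apply/negbTE; rewrite -subr_eq0 -opprD oppr_eq0.
rewrite phi_rat_quot; split.
- exists [:: Some 0; None]; split=> // [[a|]|].
  + by rewrite eq_val root_p !inE orbF.
  + by rewrite val_oo !inE ?eqxx ?orbT.
  + rewrite /= ram_index_infinity // size_p size_q (ram_val 0 0) ?root_p //.
    by rewrite scale0r subr0 pE mul_polyC mup_scale // mup_XsubCX eqxx.
- exists [:: Some (- 2^-1); Some 16^-1]; split=> [|[a|]|].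
  + by rewrite /= inE -[_ == _ :> P1 C]/(- 2^-1 == 16^-1 :> C) neq1.
  + by rewrite eq_val root_pq !inE.
  + by rewrite val_oo !inE; apply/esym/negbTE/eqP => -[/eqP]; rewrite eq_sym oner_eq0.
  + rewrite /= !(ram_val _ 1) ?root_pq ?eqxx ?orbT // pqE mul_polyC !mup_scale //.
    rewrite mupMl ?root_XsubC ?neq1 // (@mupMr _ 16^-1) ?root_exp_XsubC 1?eq_sym ?neq1 //.
    by rewrite mup_XsubCX (@mup_XsubCX _ 1) !eqxx.
- exists [:: Some 4^-1]; split=> // [[a|]|].
  + by rewrite rateval_eq_infinity // root_q !inE.
  + by rewrite val_oo !inE ?eqxx ?orbT.
  + rewrite /= ram_index_pole ?root_q // qE mul_polyC mup_scale ?oppr_eq0 //.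
    by rewrite mup_XsubCX eqxx.
Qed.

End BelyiMap.

(** * Relations between the operators *)

Section DifferentialExtensions.
Variables (C : numClosedFieldType) (K : fieldType).
Variables (j : {rmorphism {fraction {poly C}} -> K}) (D : K -> K).
Hypothesis dext : diff_ext j D.

Let DD u v : D (u + v) = D u + D v. Proof. by case: dext. Qed.
Let DM u v : D (u * v) = D u * v + u * D v. Proof. by case: dext. Qed.

Local Notation ev := (j \o @tofrac {poly C}).
Local Notation x := (ev 'X).

Let Dx : D x = 1.
Proof. by case: dext => _ _ Dj; rewrite /= Dj derivX !rmorph1. Qed.

Lemma ext_neq0 (p : {poly C}) : p != 0 -> ev p != 0.
Proof. by move=> p0; rewrite /= fmorph_eq0 tofrac_eq0. Qed.

Lemma ext_natr_neq0 n : n.+1%:R != 0 :> K.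
Proof.
rewrite -(rmorph_nat j) fmorph_eq0 -(rmorph_nat (@tofrac _)) tofrac_eq0.
by rewrite -polyC_natr polyC_eq0 pnatr_eq0.
Qed.

Let x0 : x != 0.
Proof. by rewrite ext_neq0 ?polyX_eq0. Qed.

Let w0 : 1 - 4 * x != 0.
Proof.
have -> : 1 - 4 * x = ev (1 - 4 * 'X) by rewrite rmorphB rmorphM rmorph1 rmorph_nat.
exact: ext_neq0 (one_sub_natX_neq0 C 4).
Qed.

Let v0 : 1 + 2 * x != 0.
Proof.
have -> : 1 + 2 * x = ev (1 + 2 * 'X) by rewrite rmorphD rmorphM rmorph1 rmorph_nat.
exact: ext_neq0 (one_add_natX_neq0 C 2).
Qed.

Lemma ext_act_heun u : ext_act j D (heun_op C) u = heun D x u.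
Proof. exact: (act_heun ev). Qed.

Lemma ext_act_pulled_gauss u :
  ext_act j D (pulled_gauss_op C) u = pulled_gauss D x u.
Proof. exact: (act_pulled_gauss ev). Qed.

Lemma ext_domb_of_product u v :
  ext_act j D (heun_op C) u = 0 -> ext_act j D (heun_op C) v = 0 ->
  ext_act j D (domb_op C) (u * v) = 0.
Proof.
rewrite !ext_act_heun => hu hv.
rewrite -[LHS]/(op_act ev D (domb_op C) (u * v)) act_domb.
exact: (domb_of_product DD DM Dx).
Qed.

Local Notation ph := (j (phi_rat C)).

Let phE : ph * (1 - 4 * x) ^+ 3 = 108 * x ^+ 2.
Proof.
rewrite /phi_rat /phi_of fmorph_div rmorphM !rmorphXn rmorphB rmorphM rmorph1.
by rewrite !rmorph_nat /= mulfVK // expf_neq0 // w0.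
Qed.

Let Dph : x * (1 - 4 * x) * D ph = 2 * (1 + 2 * x) * ph.
Proof. exact: (phi_deriv DD DM Dx (mulVf w0) phE). Qed.

Let Dph0 : D ph != 0.
Proof.
apply/eqP => Dph_0; have /eqP := Dph; rewrite Dph_0 mulr0 eq_sym.
rewrite !mulf_eq0 (negPf v0) (negPf (ext_natr_neq0 1)) /= => /eqP ph0.
have /eqP := phE; rewrite ph0 mul0r eq_sym mulf_eq0 expf_eq0 (negPf x0).
by rewrite (negPf (ext_natr_neq0 107)).
Qed.

(** [gauss_pullback] with t = phi (D u / D phi), which is theta u in the variable
z = phi(x).  As 4 (1 - 4x)^3 and x are invertible in K, the two equations have the
same solutions. *)
Lemma pull_act_gauss u : 4 * (1 - 4 * x) ^+ 3 *
    (18 * pull_act (phi_rat C) j D (gauss_op 6^-1 3^-1 1) u) =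
  18 * x * pulled_gauss D x u.
Proof.
pose e := j \o (horner_eval (phi_rat C) \o map_poly (@tofrac {poly C} \o polyC)).
pose D' v := D v / D ph.
have eX : e 'X = ph by rewrite /e /= /horner_eval map_polyX hornerX.
have thE v : x * (1 - 4 * x) * D v = 2 * (1 + 2 * x) * (ph * D' v).
  by rewrite mulrA -Dph /D' -[RHS]mulrA; congr (_ * _); rewrite mulrC divfK.
rewrite -(gauss_pullback DD DM Dx phE (thE u) (thE (ph * D' u))) -eX.
by congr (_ * _); exact: (act_gauss_sixth_third e D' u).
Qed.

Lemma pullback_iff u :
  pull_act (phi_rat C) j D (gauss_op 6^-1 3^-1 1) u = 0 <->
  ext_act j D (pulled_gauss_op C) u = 0.
Proof.
rewrite ext_act_pulled_gauss; have := pull_act_gauss u.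
set g := pull_act _ _ _ _ _; set p := pulled_gauss _ _ _ => gp.
have n18 := ext_natr_neq0 17; have n4 := ext_natr_neq0 3.
split=> [g0|p0].
  move/eqP: gp; rewrite g0 !mulr0 eq_sym !mulf_eq0 (negPf n18) (negPf x0) /=.
  by move/eqP.
have nz : 4 * (1 - 4 * x) ^+ 3 * 18 != 0.
  by rewrite mulf_neq0 // mulf_neq0 // expf_neq0 // w0.
by apply: (mulfI nz); rewrite -[LHS]mulrA gp p0 !mulr0.
Qed.

Lemma twist_iff s u : root (map_poly j (inv_sqrt_minpoly C)) s ->
  ext_act j D (pulled_gauss_op C) u = 0 <->
  ext_act j D (heun_op C) (s * u) = 0.
Proof.
rewrite /inv_sqrt_minpoly rmorphB /= map_polyXn map_polyC /= rootE !hornerE subr_eq0.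
rewrite fmorphV rmorphB rmorphM rmorph1 rmorph_nat => /eqP s2.
have ws2 : (1 - 4 * x) * s ^+ 2 = 1 by rewrite s2 mulfV ?w0.
have s0 : s != 0.
  by apply/eqP => s0; move/eqP: ws2; rewrite s0 expr0n mulr0 eq_sym oner_eq0.
(* Differentiating (1 - 4x) s^2 = 1. *)
have ds : (1 - 4 * x) * D s = 2 * s.
  have n2s : 2 * s != 0 by rewrite mulf_neq0 ?ext_natr_neq0.
  have dws2 : D ((1 - 4 * x) * s ^+ 2) = 0 by rewrite ws2 (derivation1 DM).
  apply: (mulfI n2s); apply/subr0_eq; rewrite -[RHS]dws2.
  by rewrite !(DD, derivationN DD, DM, derivation_nat DD DM, derivation1 DM,
    derivationXn DM, Dx); ring.
rewrite ext_act_pulled_gauss ext_act_heun; have := heun_twist DD DM Dx u ds.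
set p := pulled_gauss _ _ _; set h := heun _ _ _ => hp.
split=> [p0|h0].
  by move/eqP: hp; rewrite p0 mulr0 mulf_eq0 (negPf w0) => /eqP.
by move/eqP: hp; rewrite h0 mulr0 eq_sym mulf_eq0 (negPf s0) => /eqP.
Qed.

End DifferentialExtensions.

Section OperatorRelations.
Variable C : numClosedFieldType.

Lemma domb_sym_square_heun : is_sym_square (heun_op C) (domb_op C).
Proof.
split=> [||K j D dext u v]; [exact: heun_order | exact: domb_order |].
exact: ext_domb_of_product.
Qed.

Lemma pulled_gauss_pullback :
  is_pullback (phi_rat C) (gauss_op 6^-1 3^-1 1) (pulled_gauss_op C).
Proof.
split=> [|K j D dext u]; first by rewrite gauss_order pulled_gauss_order.
exact: pullback_iff.
Qed.

Lemma heun_twist_pulled_gauss :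
  is_alg_twist (inv_sqrt_minpoly C) (pulled_gauss_op C) (heun_op C).
Proof.
split=> [|K j D dext s rs u]; first by rewrite heun_order pulled_gauss_order.
exact: twist_iff.
Qed.

End OperatorRelations.

Theorem theorem4p13 (C : numClosedFieldType) :
  (* (a) *)
  [/\ is_belyi (phi_rat C), ratdeg (phi_rat C) = 3%N
    & has_passport (phi_rat C) [:: 2; 1]%N [:: 2; 1]%N [:: 3]%N] /\
  (* (b) *)
  fps_act (heun_op C) (y_fps C) = 0 /\
  (* (c) *)
  [/\ y_fps C ^+ 2 = Fps (fun n => (domb n)%:R),
      is_sym_square (heun_op C) (domb_op C)
    & fps_act (domb_op C) (y_fps C ^+ 2) = 0] /\
  (* (d) *)
  [/\ domb_recurrence (fun n => (domb n)%:R : C),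
      forall c : nat -> C, fps_act (domb_op C) (Fps c) = 0 <-> domb_recurrence c,
      fps_act (gauss_op 6^-1 3^-1 1) (f_gauss C) = 0
    & exists P : linop C,
      [/\ is_pullback (phi_rat C) (gauss_op 6^-1 3^-1 1) P,
          fps_act P (fps_comp (f_gauss C) (phi_fps C)) = 0,
          is_alg_twist (inv_sqrt_minpoly C) P (heun_op C)
        & is_sym_square (heun_op C) (domb_op C)]].
Proof.
split; first by split; [exact: phi_belyi | exact: phi_ratdeg | exact: phi_passport].
split; first exact: heun_y.
split.
  by split; [exact: y_sqr_domb | exact: domb_sym_square_heun | exact: domb_y2].
split; [exact: domb_numbers_recurrence | exact: domb_act_recurrence
  | exact: gauss_f_gauss | exists (pulled_gauss_op C)].
split; [exact: pulled_gauss_pullback | | exact: heun_twist_pulled_gauss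
  | exact: domb_sym_square_heun].
by rewrite /fps_act act_pulled_gauss pulled_gauss_f_phi.
Qed.
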